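(* Let $f:\mathbb{R}^2\to\mathbb{R}$ be a polynomial of degree $d\ge 1$ given by $f(\mathbf{x})=\sum_{\mathbf{v}\in\mathbb{Z}^2_+,\ \|\mathbf{v}\|_1\le d} c_{\mathbf{v}}\mathbf{x}^{\mathbf{v}}$ where $c_{\mathbf{v}}\in\mathbb{Z}$. In polynomial time in the size of the coefficients $c_{\mathbf{v}}$, one can determine whether $f$ is homogeneous translatable and, if so, compute a rational translation vector $\mathbf{t}$ such that $f(\mathbf{x}+\mathbf{t})$ is a homogeneous polynomial.
   Context: $\mathbf{x}^{\mathbf{v}}=x_1^{v_1}x_2^{v_2}$. A polynomial $f:\mathbb{R}^2\to\mathbb{R}$ is homogeneous translatable if there exists $\mathbf{t}\in\mathbb{R}^2$ such that $f(\mathbf{x}+\mathbf{t})=h(\mathbf{x})$ for some homogeneous polynomial $h$ (all monomials of the same total degree). Size means binary encoding length. *)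

(* Defs.v *)
From mathcomp Require Import all_boot all_order all_algebra.
From mathcomp Require Import mpoly.
From mathcomp Require Import reals.

Set Implicit Arguments.
Unset Strict Implicit.
Unset Printing Implicit Defensive.

Import Order.TTheory GRing.Theory Num.Theory.

Local Open Scope ring_scope.

(** * Model of computation

  "Polynomial time" refers to the random access machine with logarithmic cost
  of Aho, Hopcroft and Ullman (The Design and Analysis of Computer Algorithms,
  Sections 1.2-1.3), which is polynomially related to the multitape Turing
  machine.  Registers hold arbitrary integers, register 0 is the accumulator,
  and each instruction is charged the binary lengths of all the numbers and
  addresses it handles.  The textbook instruction DIV is left out: an existence
  statement about programs is only stronger without it. *)

(* Number of binary digits of |z|, with bitlen 0 = 1 *)
Definition bitlen (z : int) : nat := (trunc_log 2 `|z|%N).+1.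

Inductive operand :=
| Lit of int    (* the constant itself *)
| Reg of nat    (* content of a register *)
| Ind of nat.   (* content of the register whose address is in a register *)

Inductive instr :=
| LOAD of operand | STORE of operand
| ADD of operand | SUB of operand | MULT of operand
| READ of operand | WRITE of operand
| JUMP of nat | JGTZ of nat | JZERO of nat
| HALT.

Definition program := seq instr.

(* [sout] is kept in reverse order of writing. *)
Record state := State {
  spc : nat;
  sreg : nat -> int;
  sin : seq int;
  sout : seq int
}.

Definition init (input : seq int) : state := State 0 (fun=> 0) input [::].

(* Indirect addressing through a negative number is an error. *)
Definition reg_at (r : nat -> int) (a : int) : option nat :=
  if 0 <= a then Some `|a|%N else None.

Definition value (r : nat -> int) (o : operand) : option int :=
  match o with
  | Lit z => Some z
  | Reg n => Some (r n)
  | Ind n => omap r (reg_at r (r n))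
  end.

(* A literal does not denote a register. *)
Definition address (r : nat -> int) (o : operand) : option nat :=
  match o with
  | Lit _ => None
  | Reg n => Some n
  | Ind n => reg_at r (r n)
  end.

Definition value_cost (r : nat -> int) (o : operand) : nat :=
  match o with
  | Lit z => bitlen z
  | Reg n => (bitlen n%:Z + bitlen (r n))%N
  | Ind n => (bitlen n%:Z + bitlen (r n) + bitlen (r `|r n|%N))%N
  end.

Definition address_cost (r : nat -> int) (o : operand) : nat :=
  match o with
  | Lit _ => 0%N
  | Reg n => bitlen n%:Z
  | Ind n => (bitlen n%:Z + bitlen (r n))%N
  end.

Definition upd (r : nat -> int) (n : nat) (z : int) : nat -> int :=
  fun m => if m == n then z else r m.

(* The successor state; None when the machine is blocked, be it on HALT, on an
   invalid operand, on reading past the end of the input, or on a program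
   counter outside the program. *)
Definition step (P : program) (s : state) : option state :=
  let: State pc r i o := s in
  let acc (f : int -> int) a :=
    omap (fun z => State pc.+1 (upd r 0 (f z)) i o) (value r a) in
  if onth P pc is Some ins then
    match ins with
    | LOAD a => acc id a
    | STORE a =>
        omap (fun n => State pc.+1 (upd r n (r 0%N)) i o) (address r a)
    | ADD a => acc (fun z => r 0%N + z) a
    | SUB a => acc (fun z => r 0%N - z) a
    | MULT a => acc (fun z => r 0%N * z) a
    | READ a =>
        if i is z :: i' then
          omap (fun n => State pc.+1 (upd r n z) i' o) (address r a)
        else None
    | WRITE a => omap (fun z => State pc.+1 r i (z :: o)) (value r a)
    | JUMP l => Some (State l r i o)
    | JGTZ l => Some (State (if 0 < r 0%N then l else pc.+1) r i o)
    | JZERO l => Some (State (if r 0%N == 0 then l else pc.+1) r i o)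
    | HALT => None
    end
  else None.

Definition step_cost (P : program) (s : state) : nat :=
  let: State pc r i _ := s in
  if onth P pc is Some ins then
    match ins with
    | LOAD a | WRITE a => value_cost r a
    | STORE a => (bitlen (r 0%N) + address_cost r a)%N
    | ADD a | SUB a | MULT a => (bitlen (r 0%N) + value_cost r a)%N
    | READ a => (bitlen (head 0%R i) + address_cost r a)%N
    | JGTZ _ | JZERO _ => bitlen (r 0%N)
    | JUMP _ | HALT => 1%N
    end
  else 0%N.

(* From state [s], [P] reaches HALT with the sequence [out] written on its
   output tape, at total logarithmic cost [t]. *)
Inductive halts (P : program) : state -> seq int -> nat -> Prop :=
| halts_stop s :
    onth P (spc s) = Some HALT -> halts P s (rev (sout s)) (step_cost P s)
| halts_step s s' out t :
    step P s = Some s' -> halts P s' out t ->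
    halts P s out (step_cost P s + t)%N.

Definition computes (P : program) (input output : seq int) (t : nat) : Prop :=
  halts P (init input) output t.

(** * Polynomials in two variables *)

Definition mon2 (i j : nat) : 'X_{1..2} := [multinom [tuple i; j]].

(* All coefficients c_v with |v| <= d, zero ones included. *)
Definition coeffs (d : nat) (f : {mpoly int[2]}) : seq int :=
  [seq f@_(mon2 i j) | i <- iota 0 d.+1, j <- iota 0 (d.+1 - i)].

Definition coeffs_size (d : nat) (f : {mpoly int[2]}) : nat :=
  (\sum_(c <- coeffs d f) bitlen c)%N.

Definition encode_input (d : nat) (f : {mpoly int[2]}) : seq int :=
  d%:Z :: coeffs d f.

(* f(x + t) is a homogeneous polynomial in x. *)
Definition homogeneous_after (R : realType) (f : {mpoly R[2]})
    (t : 'I_2 -> R) : Prop :=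
  exists (k : nat) (h : {mpoly R[2]}),
    h \is k.-homog /\
    forall x : 'I_2 -> R, f.@[fun i => x i + t i] = h.@[x].

Definition homogeneous_translatable (R : realType) (f : {mpoly R[2]}) : Prop :=
  exists t : 'I_2 -> R, homogeneous_after f t.

(** * Output format: 0 for "no"; 1, a_1, b_1, a_2, b_2 for "yes" with
    t = (a_1 / b_1, a_2 / b_2), the fractions not necessarily reduced *)

Definition encodes_no (out : seq int) : Prop := out = [:: 0].

Definition encodes_yes (out : seq int) (t : 'I_2 -> rat) : Prop :=
  exists a b : 'I_2 -> int,
    [/\ forall i, 0 < b i,
        forall i, t i = (a i)%:~R / (b i)%:~R
      & out = [:: 1; a ord0; b ord0; a ord_max; b ord_max]].

(* Main.v *)
Require Import Defs.
From mathcomp Require Import all_boot all_order all_algebra.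
From mathcomp Require Import mpoly.
From mathcomp Require Import boolp.
From mathcomp Require Import reals.
From mathcomp Require Import zify ring lra.
Import Order.TTheory GRing.Theory Num.Theory.

Set Implicit Arguments.
Unset Strict Implicit.
Unset Printing Implicit Defensive.

Local Open Scope ring_scope.

(** Euler's identity makes the problem linear.  In characteristic 0 a polynomial
  g is homogeneous of degree k iff x . grad g = k g, so f(x + t) is homogeneous
  of degree k iff (x - t) . grad f = k f ([translate_homog_euler]).  When f has
  degree d this forces k = d, and comparing the coefficients of x1^i x2^j gives

    (i+1) c_(i+1,j) t1 + (j+1) c_(i,j+1) t2 = (i+j-d) c_(i,j).

  Hence f is translatable by t iff t solves this integral linear system in two
  unknowns ([euler_system]), and every rational solution is a translation.

  The system a t1 + b t2 = e, with a, b and e the columns of coefficients, is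
  decided by least squares, which needs no pivoting: only the six inner products
  of a, b and e matter.  Cramer's rule on the normal equations yields the
  candidate if the Gram determinant D = (a.a)(b.b) - (a.b)^2 is nonzero; if
  D = 0, then a and b are proportional and (a.e, b.e) / (a.a + b.b) is a least
  squares solution.  In both cases the common denominator is a positive integer,
  and the candidate is a solution iff its squared residual, a rational function
  of the six products, vanishes ([lsq_exactP], [lsq_exact_of_solution]).

  The program reads the coefficients once, row after row, and keeps the previous
  row in memory, so that each new coefficient completes one equation, whose
  contribution is added to the six sums ([loop_inv]).

  For the cost, one instruction multiplies the bit length of the numbers in the
  machine at most by a constant depending on the program.  A bounded number of
  instructions started where all numbers have at most L bits therefore costs
  O(L) ([steps_reach]), and numbers have to be bounded at the head of the loop
  only.  There L = 6 S works, where S is the size of the coefficients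
  ([loop_inv_wide]).  As d < S, the head of the loop is reached O(S^2) times,
  and the total cost is O(S^3) ([prog_answers]). *)

(** * Least squares in two unknowns *)

Section LeastSquaresDefs.
Variables (F : realDomainType) (I : eqType) (ks : seq I).

Definition dot (u v : I -> F) : F := \sum_(k <- ks) u k * v k.

(** The determinant of the normal equations of a t1 + b t2 = e, where a, b and e
  are viewed as vectors indexed by [ks]. *)
Definition gram_det (a b : I -> F) : F := dot a a * dot b b - dot a b * dot a b.

(** [lsq_num1 / lsq_den] and [lsq_num2 / lsq_den] are the coordinates of a least
  squares solution.  For a nonzero singular Gram matrix G of trace tr, G = tr P with
  P an orthogonal projection whose image contains g = (a.e, b.e); so g / tr solves
  the normal equations. *)
Definition lsq_den (a b : I -> F) : F :=
  if gram_det a b == 0 then dot a a + dot b b else gram_det a b.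

Definition lsq_num1 (a b e : I -> F) : F :=
  if gram_det a b == 0 then dot a e else dot a e * dot b b - dot a b * dot b e.

Definition lsq_num2 (a b e : I -> F) : F :=
  if gram_det a b == 0 then dot b e else dot a a * dot b e - dot a b * dot a e.

(** For a solution t of the normal equations the squared residual is
  e.e - t1 (a.e) - t2 (b.e); it vanishes iff t solves the system itself. *)
Definition lsq_exact (a b e : I -> F) : bool :=
  lsq_num1 a b e * dot a e + lsq_num2 a b e * dot b e == lsq_den a b * dot e e.

End LeastSquaresDefs.

Section LeastSquares.
Variables (F : realDomainType) (I : eqType) (ks : seq I) (a b : I -> F).
Local Notation "<< u , v >>" := (dot ks u v).
Local Notation D := (gram_det ks a b).

Lemma dotC (u v : I -> F) : << u, v >> = << v, u >>.
Proof. by apply: eq_bigr => k _; rewrite mulrC. Qed.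

(** The scalar s stands for the common denominator of the unknowns. *)
Lemma sum_sqr_residual (e : I -> F) (t1 t2 s : F) :
  \sum_(k <- ks) (a k * t1 + b k * t2 - s * e k) ^+ 2 =
  << a, a >> * t1 ^+ 2 + << a, b >> * t1 * t2 *+ 2 + << b, b >> * t2 ^+ 2
  - (<< a, e >> * t1 + << b, e >> * t2) * s *+ 2 + << e, e >> * s ^+ 2.
Proof.
rewrite /dot; elim: (ks) => [|k l IH]; first by rewrite !big_nil; ring.
by rewrite !big_cons IH; ring.
Qed.

Lemma sum_sqr_eq0 (G : I -> F) :
  \sum_(k <- ks) G k ^+ 2 = 0 -> {in ks, forall k, G k = 0}.
Proof.
move=> /eqP; rewrite psumr_eq0 => [/allP h k /h|k _]; last exact: sqr_ge0.
by rewrite /= sqrf_eq0 => /eqP.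
Qed.

Lemma dot_ge0 (u : I -> F) : 0 <= << u, u >>.
Proof. by apply: sumr_ge0 => k _; rewrite -expr2 sqr_ge0. Qed.

Lemma dot_eq0 (u : I -> F) : << u, u >> = 0 -> {in ks, forall k, u k = 0}.
Proof.
by move=> u0; apply: sum_sqr_eq0; rewrite -[RHS]u0; apply: eq_bigr => k _; rewrite expr2.
Qed.

(** The vector (a.a) b - (a.b) a is (a.a) times the component of b orthogonal to
  a.  This gives the Cauchy-Schwarz inequality, and the proportionality of a and
  b in the case of equality. *)
Lemma sum_sqr_minor :
  \sum_(k <- ks) (<< a, a >> * b k - << a, b >> * a k) ^+ 2 = << a, a >> * D.
Proof.
transitivity (\sum_(k <- ks) (a k * - << a, b >> + b k * << a, a >> - 0 * a k) ^+ 2).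
  by apply: eq_bigr => k _; ring.
by rewrite sum_sqr_residual /gram_det; ring.
Qed.

Lemma gram_det_ge0 : 0 <= D.
Proof.
have [Saa0|Saa_neq0] := eqVneq << a, a >> 0.
  suff Sab0 : << a, b >> = 0 by rewrite /gram_det Saa0 Sab0; lra.
  by rewrite /dot big_seq big1 // => k /(dot_eq0 Saa0) ->; rewrite mul0r.
have Saa_gt0 : 0 < << a, a >> by rewrite lt_def Saa_neq0 dot_ge0.
rewrite -(pmulr_rge0 _ Saa_gt0) -sum_sqr_minor.
by apply: sumr_ge0 => k _; apply: sqr_ge0.
Qed.

(** A Gram determinant is nonnegative, which gives the denominator the sign required
  of an output. *)
Lemma lsq_den_gt0 k : k \in ks -> (a k != 0) || (b k != 0) -> 0 < lsq_den ks a b.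
Proof.
move=> kin abk; rewrite /lsq_den; case: eqP => [_|/eqP D0]; last first.
  by rewrite lt_def D0 gram_det_ge0.
rewrite lt_def addr_ge0 ?dot_ge0 // andbT paddr_eq0 ?dot_ge0 //.
by apply: contraL abk => /andP[/eqP/dot_eq0-> // /eqP/dot_eq0->]; rewrite ?eqxx.
Qed.

End LeastSquares.

Section LeastSquaresSolution.
Variables (F : realDomainType) (I : eqType) (ks : seq I) (a b e : I -> F).
Local Notation "<< u , v >>" := (dot ks u v).

(** If the Gram determinant vanishes, (x.x) y = (x.y) x; take the product with e. *)
Lemma gram_det0_minor (x y : I -> F) : gram_det ks x y = 0 ->
  << x, x >> * << y, e >> = << x, y >> * << x, e >>.
Proof.
move=> D0; rewrite [<< y, e >>]/dot [<< x, e >>]/dot !mulr_sumr.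
apply: eq_big_seq => k kin; rewrite !mulrA; congr (_ * _).
apply/eqP; rewrite -subr_eq0; apply/eqP; move: k kin; apply: sum_sqr_eq0.
by rewrite sum_sqr_minor // D0 mulr0.
Qed.

(** The normal equations hold at the candidate, so the sum of the squares of the
  residuals reduces to the quantity tested by [lsq_exact]; a vanishing sum of
  squares has vanishing terms. *)
Lemma lsq_exactP : lsq_exact ks a b e ->
  {in ks, forall k,
    a k * lsq_num1 ks a b e + b k * lsq_num2 ks a b e = lsq_den ks a b * e k}.
Proof.
move=> /eqP hres k kin; apply/eqP; rewrite -subr_eq0; apply/eqP.
move: k kin; apply: sum_sqr_eq0; rewrite sum_sqr_residual.
suff [h1 h2] :
    << a, a >> * lsq_num1 ks a b e + << a, b >> * lsq_num2 ks a b e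
      = lsq_den ks a b * << a, e >> /\
    << a, b >> * lsq_num1 ks a b e + << b, b >> * lsq_num2 ks a b e
      = lsq_den ks a b * << b, e >>.
  move: hres h1 h2; set t1 := lsq_num1 _ _ _ _; set t2 := lsq_num2 _ _ _ _.
  set den := lsq_den _ _ _ => hres h1 h2.
  have -> : << e, e >> * den ^+ 2 = den * (t1 * << a, e >> + t2 * << b, e >>).
    by rewrite hres; ring.
  have -> : << a, a >> * t1 ^+ 2 + << a, b >> * t1 * t2 *+ 2 + << b, b >> * t2 ^+ 2 =
    t1 * (<< a, a >> * t1 + << a, b >> * t2) + t2 * (<< a, b >> * t1 + << b, b >> * t2) by ring.
  by rewrite h1 h2; ring.
rewrite /lsq_num1 /lsq_num2 /lsq_den; case: eqP => [D0|_]; last first.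
  by split; rewrite /gram_det; ring.
have h1 := gram_det0_minor D0.
have h2 : << b, b >> * << a, e >> = << a, b >> * << b, e >>.
  rewrite (dotC ks a b); apply: gram_det0_minor.
  by rewrite -D0 /gram_det (dotC ks b a); ring.
by split; [rewrite -h2|rewrite -h1]; ring.
Qed.

End LeastSquaresSolution.

(** Any solution s expresses a.e, b.e and e.e through a.a, a.b and b.b.  After this
  substitution the two sides of the test agree identically if D is nonzero, and
  differ by -(s1^2 + s2^2) D if the singular formulas are used. *)
Lemma lsq_exact_of_solution (F : realDomainType) (I : eqType) (ks : seq I)
    (a b e : I -> F) (s1 s2 : F) :
  {in ks, forall k, a k * s1 + b k * s2 = e k} -> lsq_exact ks a b e.
Proof.
move=> sol.
have dote x : dot ks x e = dot ks x a * s1 + dot ks x b * s2.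
  rewrite /dot !mulr_suml -big_split; apply: eq_big_seq => k kin.
  by rewrite /= -sol //; ring.
rewrite /lsq_exact /lsq_num1 /lsq_num2 /lsq_den.
have e1 := dote a; have e2 := dote b; have e3 := dote e.
rewrite (dotC ks b a) in e2; rewrite (dotC ks e a) (dotC ks e b) in e3.
case: (gram_det ks a b =P 0) => [D0|_]; apply/eqP; last by rewrite e3 /gram_det e1 e2; ring.
apply/eqP; rewrite -subr_eq0; apply/eqP.
transitivity (- (s1 ^+ 2 + s2 ^+ 2) * gram_det ks a b); last by rewrite D0 mulr0.
by rewrite e3 /gram_det e1 e2; ring.
Qed.

(** The machine computes with integers, while solutions live in a field. *)
Section LeastSquaresInt.
Variables (F : realDomainType) (I : eqType) (ks : seq I) (a b e : I -> int).
Let toF (u : I -> int) : I -> F := fun k => (u k)%:~R.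

Lemma dot_intr u v : dot ks (toF u) (toF v) = (dot ks u v)%:~R.
Proof. by rewrite /dot rmorph_sum; apply: eq_bigr => k _; rewrite /toF rmorphM. Qed.

Lemma gram_det_intr : gram_det ks (toF a) (toF b) = (gram_det ks a b)%:~R.
Proof. by rewrite /gram_det !dot_intr rmorphB !rmorphM. Qed.

Lemma lsq_den_intr : lsq_den ks (toF a) (toF b) = (lsq_den ks a b)%:~R.
Proof.
by rewrite /lsq_den !dot_intr gram_det_intr intr_eq0; case: ifP; rewrite ?rmorphD.
Qed.

Lemma lsq_num1_intr : lsq_num1 ks (toF a) (toF b) (toF e) = (lsq_num1 ks a b e)%:~R.
Proof.
by rewrite /lsq_num1 !dot_intr gram_det_intr intr_eq0; case: ifP; rewrite ?rmorphB ?rmorphM.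
Qed.

Lemma lsq_num2_intr : lsq_num2 ks (toF a) (toF b) (toF e) = (lsq_num2 ks a b e)%:~R.
Proof.
by rewrite /lsq_num2 !dot_intr gram_det_intr intr_eq0; case: ifP; rewrite ?rmorphB ?rmorphM.
Qed.

Lemma lsq_exact_intr : lsq_exact ks (toF a) (toF b) (toF e) = lsq_exact ks a b e.
Proof.
rewrite /lsq_exact lsq_den_intr lsq_num1_intr lsq_num2_intr !dot_intr.
by rewrite -!intrM -intrD eqr_int.
Qed.

End LeastSquaresInt.

(** * Translations and Euler's identity *)

Lemma horner_eq0_poly (R : numDomainType) (q : {poly R}) :
  (forall x, q.[x] = 0) -> q = 0.
Proof.
move=> q0; apply/eqP/negPn/negP => qn0.
have uq : uniq [seq i%:R : R | i <- iota 0 (size q)].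
  by rewrite map_inj_uniq ?iota_uniq // => i j /eqP; rewrite eqr_nat => /eqP.
have := max_poly_roots qn0 _ uq.
rewrite size_map size_iota ltnn => roots_lt; apply: notF; apply: roots_lt.
by apply/allP => x _; rewrite rootE q0.
Qed.

Lemma mon2E (m : 'X_{1..2}) : m = mon2 (m ord0) (m ord_max).
Proof.
apply/mnmP => i; rewrite /mon2 multinomE.
by case: i => -[|[|//]] hi; rewrite (tnth_nth 0%N) /=; congr (m _); apply: val_inj.
Qed.

Lemma mon2_0 i j : mon2 i j ord0 = i. Proof. by rewrite multinomE (tnth_nth 0%N). Qed.
Lemma mon2_1 i j : mon2 i j ord_max = j. Proof. by rewrite multinomE (tnth_nth 0%N). Qed.

(** Homogeneity after a translation is stated through values, whereas the argument
  compares coefficients.  A polynomial vanishing everywhere is zero: fix the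
  second variable to get a polynomial in the first, then let the second vary. *)
Lemma mpoly2_ext (R : numDomainType) (p q : {mpoly R[2]}) :
  (forall x : 'I_2 -> R, p.@[x] = q.@[x]) -> p = q.
Proof.
move=> pq; apply/eqP; rewrite -subr_eq0; apply/eqP.
have : forall x, (p - q).@[x] = 0 by move=> x; rewrite mevalB pq subrr.
move: (p - q) => {pq q}p p0; apply/mpolyP => m; rewrite mcoeff0.
pose px y := \sum_(m <- msupp p) (p@_m * y ^+ m ord_max) *: 'X^(m ord0).
have px0 y : px y = 0.
  apply: horner_eq0_poly => x.
  rewrite -[RHS](p0 (fun i => if i == ord0 then x else y)).
  rewrite mevalE horner_sum; apply: eq_bigr => n _.
  rewrite hornerZ hornerXn !big_ord_recl big_ord0 mulr1 /=.
  have -> : lift ord0 ord0 = ord_max :> 'I_2 by exact: val_inj.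
  by rewrite -mulrA [y ^+ _ * _]mulrC.
pose py k := \sum_(m <- msupp p | m ord0 == k) p@_m *: 'X^(m ord_max).
have py0 k : py k = 0.
  apply: horner_eq0_poly => y; rewrite -[RHS](coef0 R k) -(px0 y) coef_sum horner_sum.
  rewrite [LHS]big_mkcond; apply: eq_bigr => n _.
  rewrite coefZ coefXn eq_sym; case: eqP => _; rewrite ?mulr1 ?mulr0 //.
  by rewrite hornerZ hornerXn.
have := congr1 (fun r : {poly R} => r`_(m ord_max)) (py0 (m ord0)).
rewrite coef0 coef_sum => <-.
have [mp|mp] := boolP (m \in msupp p); last first.
  rewrite memN_msupp_eq0 // big_seq_cond big1 // => n /andP[np /eqP n0].
  rewrite coefZ coefXn; case: eqP => [n1|]; rewrite ?mulr0 //.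
  by move: mp; rewrite (mon2E m) n1 -n0 -mon2E np.
rewrite big_mkcond (bigD1_seq m) //= eqxx coefZ coefXn eqxx mulr1 big1 ?addr0 // => n nm.
case: eqP => // n0; rewrite coefZ coefXn; case: eqP => [n1|]; rewrite ?mulr0 //.
by move: nm; rewrite (mon2E m) n1 -n0 -mon2E eqxx.
Qed.

Section Translation.
Variables (R : comNzRingType) (n : nat) (t : 'I_n -> R).

Definition translate (p : {mpoly R[n]}) : {mpoly R[n]} :=
  p \mPo [tuple 'X_i + (t i)%:MP | i < n].

Lemma meval_translate p x : (translate p).@[x] = p.@[fun i => x i + t i].
Proof.
rewrite comp_mpoly_meval; apply: meval_eq => i.
by rewrite tnth_mktuple mevalD mevalXU mevalC.
Qed.

(** The chain rule for a translation.  Both sides are linear and satisfy the product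
  rule, so it suffices to check the variables. *)
Lemma mderiv_translate p i : (translate p)^`M(i) = translate p^`M(i).
Proof.
pose good q := (translate q)^`M(i) == translate q^`M(i).
have goodM q r : good q -> good r -> good (q * r).
  rewrite /good /translate => /eqP hq /eqP hr.
  by rewrite rmorphM !mderivM rmorphD !rmorphM /= hq hr.
have good1 : good 1.
  by rewrite /good /translate rmorph1 -mpolyC1 !mderivC comp_mpoly0.
have goodX j k : good ('X_j ^+ k).
  elim: k => [|k IH]; first by rewrite expr0.
  rewrite exprS; apply: (goodM 'X_j _ _ IH); rewrite /good /translate comp_mpolyXU.
  rewrite -tnth_nth tnth_mktuple mderivD mderivC addr0 !mderivX mnm1E.
  case: (j =P i) => [->|_]; last by rewrite !scale0r comp_mpoly0.
  have -> : (U_(i) - U_(i) = 0 :> 'X_{1..n})%MM.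
    by apply/mnmP => l; rewrite mnmBE mnm0E subnn.
  by rewrite !scale1r mpolyX0 comp_mpoly1.
have goodXm m : good 'X_[m].
  rewrite mpolyXE_id; exact: (big_ind good good1 goodM (fun j _ => goodX j (m j))).
apply/eqP; elim/mpolyind: p => [|c m q _ _ /eqP IH].
  by rewrite /good /translate mderiv0 !comp_mpoly0 mderiv0.
rewrite /translate comp_mpolyD !mderivD comp_mpolyD comp_mpolyZ !mderivZ comp_mpolyZ.
by rewrite -!/(translate _) IH (eqP (goodXm m)).
Qed.

End Translation.

Section Euler.
Variables (R : numDomainType) (n : nat).

(** Monomials are eigenvectors of the operators 'X_i d/d'X_i. *)
Lemma mcoeff_mulXderiv (p : {mpoly R[n]}) i m :
  ('X_i * p^`M(i))@_m = p@_m *+ m i.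
Proof.
have [mi|mi] := posnP (m i).
  rewrite mi mulr0n [p^`M(i)]mpolyE mulr_sumr raddf_sum big1 //= => k _.
  rewrite -scalerAr mcoeffZ -mpolyXD mcoeffX.
  case: ((U_(i) + k)%MM =P m) => [km|]; rewrite ?mulr0 //.
  by move: mi; rewrite -km mnmDE mnm1E eqxx.
have [k ->] : exists k, m = (k + U_(i))%MM.
  by exists (m - U_(i))%MM; rewrite submK // lep1mP -lt0n.
by rewrite [_ * p^`M(i)]mulrC addmC mcoeffMX mcoeff_deriv addmC mnmDE mnm1E eqxx.
Qed.

(** Euler's identity and its converse: the monomial of exponent m is an eigenvector
  of the Euler operator for the eigenvalue [mdeg m]. *)
Lemma homog_euler (p : {mpoly R[n]}) k :
  (p \is k.-homog) <-> \sum_i 'X_i * p^`M(i) = p *+ k.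
Proof.
have eulerE m : (\sum_i 'X_i * p^`M(i))@_m = p@_m *+ mdeg m.
  rewrite raddf_sum mdegE -sumrMnr /=; apply: eq_bigr => i _.
  exact: mcoeff_mulXderiv.
split=> [hp|eul].
  apply/mpolyP => m; rewrite eulerE mcoeffMn.
  have [mp|mp] := boolP (m \in msupp p); last by rewrite memN_msupp_eq0 // !mul0rn.
  by rewrite (dhomog_mf hp mp).
apply/dhomogP => m mp; have := eulerE m; rewrite eul mcoeffMn => /eqP.
rewrite -subr_eq0 -mulr_natr -[X in _ - X]mulr_natr -mulrBr mulf_eq0.
rewrite mcoeff_eq0 mp /= subr_eq0 eqr_nat => /eqP -> //.
Qed.

End Euler.

Section EulerTranslate.
Variables (R : numDomainType) (t : 'I_2 -> R) (p : {mpoly R[2]}) (k : nat).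

(** Euler's identity for the translated polynomial, after the change of variables
  x := x - t. *)
Lemma translate_homog_euler :
  translate t p \is k.-homog <->
  \sum_i ('X_i - (t i)%:MP) * p^`M(i) = p *+ k.
Proof.
rewrite homog_euler; split=> h; apply: mpoly2_ext => x.
  have /(congr1 (meval (fun i => x i - t i))) := h.
  rewrite !mevalMn meval_translate !raddf_sum /=.
  have xt q : q.@[fun i => x i - t i + t i] = q.@[x].
    by apply: meval_eq => i; rewrite subrK.
  rewrite xt => <-; apply: eq_bigr => i _.
  by rewrite mderiv_translate !mevalM meval_translate xt mevalB !mevalXU mevalC.
have /(congr1 (meval (fun i => x i + t i))) := h.
rewrite !mevalMn meval_translate !raddf_sum /= => <-; apply: eq_bigr => i _.
by rewrite mderiv_translate !mevalM meval_translate mevalB !mevalXU mevalC addrK.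
Qed.

Lemma translated_euler_coeff :
  \sum_i ('X_i - (t i)%:MP) * p^`M(i) = p *+ k <->
  forall m, \sum_i t i * (p@_(m + U_(i)) *+ (m i).+1) = p@_m *+ mdeg m - p@_m *+ k.
Proof.
have coefE m : (\sum_i ('X_i - (t i)%:MP) * p^`M(i))@_m =
    p@_m *+ mdeg m - \sum_i t i * (p@_(m + U_(i)) *+ (m i).+1).
  rewrite raddf_sum mdegE -sumrMnr -sumrB /=; apply: eq_bigr => i _.
  by rewrite mulrBl mcoeffB mcoeff_mulXderiv mcoeffCM mcoeff_deriv.
split=> [h m|h].
  by rewrite -[p@_m *+ k]mcoeffMn -h coefE opprB addrC subrK.
by apply/mpolyP => m; rewrite coefE h mcoeffMn opprB addrC subrK.
Qed.

End EulerTranslate.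

(** * Translatability as a linear system *)

(** The pairs read before (i, j), row by row, row x being of length d + 1 - x. *)
Definition cells (d i j : nat) : seq (nat * nat) :=
  [seq (x, y) | x <- iota 0 i, y <- iota 0 (d.+1 - x)] ++ [seq (i, y) | y <- iota 0 j].

Lemma cells_next d i j : cells d i j.+1 = rcons (cells d i j) (i, j).
Proof. by rewrite /cells -(addn1 j) iotaD map_cat /= catA cats1. Qed.

Lemma cells_row d i : cells d i (d.+1 - i) = cells d i.+1 0.
Proof. by rewrite /cells cats0 -(addn1 i) iotaD allpairs_cat /= cats0. Qed.

Lemma mem_cells d x y : ((x, y) \in cells d d.+1 0) = (x + y <= d)%N.
Proof.
rewrite /cells cats0; apply/allpairsPdep/idP => [[u [v []]]|xy].
  by rewrite !mem_iota => ? ? [-> ->]; lia.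
by exists x, y; rewrite !mem_iota; split=> //; lia.
Qed.

Section System.
Variables (d : nat) (c : nat -> nat -> int).

(** The coefficient one row earlier; above row 0 there are zeros. *)
Definition above (i j : nat) : int := if i is i'.+1 then c i' j else 0.

(** Cell (x, y) carries the equation a t1 + b t2 = e of the monomial of exponent
  (x - 1, y): this is the moment when all the coefficients which it involves have
  been read.  Row 0 carries only the equation 0 = 0. *)
Definition eq_a (k : nat * nat) : int := k.1%:Z * c k.1 k.2.
Definition eq_b (k : nat * nat) : int := k.2.+1%:Z * above k.1 k.2.+1.
Definition eq_e (k : nat * nat) : int := ((k.1 + k.2)%:Z - d.+1%:Z) * above k.1 k.2.

End System.

Section Characterisation.
Variables (R : realType) (d : nat) (f : {mpoly int[2]}).
Hypotheses (d_gt0 : (1 <= d)%N) (size_f : msize f = d.+1).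
Let fR : {mpoly R[2]} := map_mpoly intr f.
Let c i j := f@_(mon2 i j).
Local Notation ks := (cells d d.+1 0).

Lemma coeff_gt_degree m : (d < mdeg m)%N -> f@_m = 0.
Proof.
by move=> dm; apply/eqP; rewrite mcoeff_eq0; apply/negP => /msize_mdeg_lt; lia.
Qed.

Lemma leading_cell : exists2 m, mdeg m = d & f@_m != 0.
Proof.
have f0 : f != 0 by rewrite -msize_poly_eq0 size_f.
by exists (mlead f); [apply: succn_inj; rewrite mlead_deg | rewrite mleadc_eq0].
Qed.

Lemma mon2_addU0 i j : (mon2 i j + U_(ord0))%MM = mon2 i.+1 j.
Proof.
by rewrite [LHS]mon2E !mnmDE !mnm1E mon2_0 mon2_1 addn0 addn1.
Qed.

Lemma mon2_addU1 i j : (mon2 i j + U_(ord_max))%MM = mon2 i j.+1.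
Proof.
by rewrite [LHS]mon2E !mnmDE !mnm1E mon2_0 mon2_1 addn0 addn1.
Qed.

Lemma mdeg_mon2 i j : mdeg (mon2 i j) = (i + j)%N.
Proof.
rewrite mdegE !big_ord_recl big_ord0 addn0 mon2_0.
by have -> : lift ord0 ord0 = ord_max :> 'I_2; [exact: val_inj|rewrite mon2_1].
Qed.

Lemma homogeneous_after_translate (t : 'I_2 -> R) :
  homogeneous_after fR t <-> exists k, translate t fR \is k.-homog.
Proof.
split=> [[k [h [hh fh]]]|[k hk]]; exists k.
  rewrite (_ : translate t fR = h) //; apply: mpoly2_ext => x.
  by rewrite meval_translate.
by exists (translate t fR); split=> // x; rewrite meval_translate.
Qed.

(** The coefficients of a homogeneous polynomial f(x + t) of degree k satisfy the
  Euler system with k in place of d, and its equation at a leading monomial of f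
  reads d = k.  Conversely, the equations that no cell carries are those at
  monomials of degree at least d, and they are trivial. *)
Lemma euler_system (t : 'I_2 -> R) :
  homogeneous_after fR t <->
  {in ks, forall k, (eq_a c k)%:~R * t ord0 + (eq_b c k)%:~R * t ord_max
                    = (eq_e d c k)%:~R}.
Proof.
have lastE (G : 'I_2 -> R) : \sum_i G i = G ord0 + G ord_max.
  rewrite !big_ord_recl big_ord0 addr0; congr (_ + G _); exact: val_inj.
have fRE m : fR@_m = (f@_m)%:~R by rewrite mcoeff_map_mpoly.
rewrite homogeneous_after_translate; split=> [[k]|sol].
  rewrite translate_homog_euler translated_euler_coeff => eul.
  have kd : k = d.
    have [m dm fm] := leading_cell.
    have := eul m; rewrite big1 => [|i _]; last first.
      by rewrite fRE coeff_gt_degree ?mul0rn ?mulr0 // mdegD mdeg1; lia.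
    move=> /esym/eqP; rewrite subr_eq0 -mulr_natr -[X in _ == X]mulr_natr.
    rewrite fRE; have fm' : (f@_m)%:~R != 0 :> R by rewrite intr_eq0.
    by rewrite (inj_eq (mulfI fm')) eqr_nat dm => /eqP.
  case=> [[|i] j] /=; rewrite mem_cells => ij.
    by rewrite /eq_a /eq_b /eq_e /= !mul0r !mulr0 !mul0r addr0.
  have := eul (mon2 i j); rewrite lastE !fRE mon2_addU0 mon2_addU1 mdeg_mon2.
  rewrite mon2_0 mon2_1 kd /eq_a /eq_b /eq_e /= -/(c _ _) -/(c _ _) -/(c _ _).
  rewrite !rmorphM rmorphB /= -!pmulrn => E.
  transitivity ((c i j)%:~R *+ (i + j) - (c i j)%:~R *+ d : R).
    by rewrite -E -mulr_natl -[X in t ord_max * X]mulr_natl; ring.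
  by rewrite -mulr_natl -[X in _ - X]mulr_natl !natrD -!natr1; ring.
exists d; rewrite translate_homog_euler translated_euler_coeff => m.
have [md|md] := ltnP (mdeg m) d; last first.
  rewrite big1 => [|i _]; last first.
    by rewrite fRE coeff_gt_degree ?mul0rn ?mulr0 // mdegD mdeg1; lia.
  move: md; rewrite leq_eqVlt => /orP[/eqP<-|md]; first by rewrite subrr.
  by rewrite fRE coeff_gt_degree // !mul0rn subrr.
rewrite (mon2E m) mdeg_mon2 in md *; move: (m ord0) (m ord_max) md => i j md.
have := sol (i.+1, j); rewrite mem_cells => /(_ md).
rewrite lastE !fRE mon2_addU0 mon2_addU1 mon2_0 mon2_1.
rewrite /eq_a /eq_b /eq_e /= -/(c _ _) -/(c _ _) -/(c _ _).
rewrite !rmorphM rmorphB /= -!pmulrn => E.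
transitivity ((i.+1 + j)%:R * (c i j)%:~R - d.+1%:R * (c i j)%:~R : R).
  by rewrite -mulrBl -E -mulr_natl -[X in t ord_max * X]mulr_natl; ring.
by rewrite -[X in _ = X - _]mulr_natl -[X in _ = _ - X]mulr_natl !natrD -!natr1; ring.
Qed.

(** A nonzero leading coefficient, d being positive, occurs in the column a or in
  the column b. *)
Lemma system_den_gt0 : 0 < lsq_den ks (eq_a c) (eq_b c).
Proof.
have [m dm fm] := leading_cell.
rewrite (mon2E m) mdeg_mon2 in dm fm; move: (m ord0) (m ord_max) dm fm => i j ij cij.
case: i ij cij => [|i] ij cij.
  have k_in : (1, j.-1)%N \in ks by rewrite mem_cells; lia.
  apply: (lsq_den_gt0 k_in); apply/orP; right; rewrite /eq_b /= prednK; last by lia.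
  by rewrite mulf_neq0 //; lia.
have k_in : (i.+1, j) \in ks by rewrite mem_cells; lia.
by apply: (lsq_den_gt0 k_in); rewrite /eq_a /= mulf_neq0.
Qed.

Definition solution (i : 'I_2) : rat :=
  (if i == ord0 then lsq_num1 ks (eq_a c) (eq_b c) (eq_e d c)
   else lsq_num2 ks (eq_a c) (eq_b c) (eq_e d c))%:~R
  / (lsq_den ks (eq_a c) (eq_b c))%:~R.

Lemma solution_correct : lsq_exact ks (eq_a c) (eq_b c) (eq_e d c) ->
  homogeneous_after fR (fun i => ratr (solution i)).
Proof.
rewrite -(lsq_exact_intr R) => /lsq_exactP sol; apply/euler_system => k kin.
have := sol k kin; rewrite lsq_num1_intr lsq_num2_intr lsq_den_intr.
rewrite /solution /= !fmorph_div /= !ratr_int => E.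
have den0 : (lsq_den ks (eq_a c) (eq_b c))%:~R != 0 :> R.
  by rewrite intr_eq0 gt_eqF // system_den_gt0.
apply: (mulfI den0); rewrite -E; field.
exact: den0.
Qed.

Lemma solution_complete : homogeneous_translatable fR ->
  lsq_exact ks (eq_a c) (eq_b c) (eq_e d c).
Proof.
by case=> t /euler_system sol; rewrite -(lsq_exact_intr R); apply: lsq_exact_of_solution sol.
Qed.

End Characterisation.

(** * Cost of bounded computations *)

Lemma bitlen_gt0 z : (0 < bitlen z)%N. Proof. by []. Qed.

Lemma bitlen_leq z L : (0 < L)%N -> (bitlen z <= L)%N = (`|z| < 2 ^ L)%N.
Proof.
case: L => // L _; rewrite /bitlen ltnS; apply/idP/idP => h.
  apply: leq_trans (trunc_log_ltn _ (isT : (1 < 2)%N)) _.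
  by rewrite leq_exp2l.
have [->|z0] := posnP `|z|%N; first by rewrite trunc_log0.
rewrite -ltnS -(ltn_exp2l _ _ (isT : (1 < 2)%N)).
exact: leq_ltn_trans (trunc_logP (isT : (1 < 2)%N) z0) h.
Qed.

Lemma absz_bitlen z : (`|z| < 2 ^ bitlen z)%N.
Proof. by rewrite -bitlen_leq. Qed.

Lemma bitlenD x y : (bitlen (x + y) <= bitlen x + bitlen y)%N.
Proof.
rewrite bitlen_leq //; have := absz_bitlen x; have := absz_bitlen y.
have : (2 ^ bitlen x + 2 ^ bitlen y <= 2 ^ (bitlen x + bitlen y))%N.
  rewrite expnD; set X := (2 ^ _)%N; set Y := (2 ^ _)%N.
  have : (2 <= X)%N by rewrite /X /bitlen expnS leq_pmulr // expn_gt0.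
  have : (2 <= Y)%N by rewrite /Y /bitlen expnS leq_pmulr // expn_gt0.
  by nia.
lia.
Qed.

Lemma bitlenN x : bitlen (- x) = bitlen x.
Proof. by rewrite /bitlen abszN. Qed.

Lemma bitlenM x y : (bitlen (x * y) <= bitlen x + bitlen y)%N.
Proof.
by rewrite bitlen_leq // abszM expnD ltn_mul // absz_bitlen.
Qed.

Fixpoint steps (P : program) (n : nat) (s : state) : option state :=
  if n is m.+1 then obind (steps P m) (step P s) else Some s.

(** Computations are composed from the left, in contrast to [halts], by transporting
  every halting computation from [s'] back to [s]. *)
Definition reach (P : program) (s s' : state) (t : nat) : Prop :=
  forall out T, halts P s' out T -> halts P s out (t + T).

Lemma reach_trans P s1 s2 s3 t1 t2 :
  reach P s1 s2 t1 -> reach P s2 s3 t2 -> reach P s1 s3 (t1 + t2).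
Proof. by move=> h1 h2 out T h; rewrite -addnA; apply/h1/h2. Qed.

(** The output tape does not occur, since what is written is never read again. *)
Definition wide (L : nat) (s : state) : Prop :=
  (forall k, bitlen (sreg s k) <= L)%N /\ all (fun z => bitlen z <= L)%N (sin s).

Definition operand_size (o : operand) : nat :=
  match o with Lit z => bitlen z | Reg n | Ind n => bitlen n%:Z end.

Definition instr_size (ins : instr) : nat :=
  match ins with
  | LOAD o | STORE o | ADD o | SUB o | MULT o | READ o | WRITE o => operand_size o
  | _ => 1
  end.

Lemma value_bounds L r o :
  (0 < L)%N -> (forall k, bitlen (r k) <= L)%N ->
  (value_cost r o <= operand_size o + 2 * L)%N /\
  (forall z, value r o = Some z -> bitlen z <= operand_size o + L)%N.
Proof.
move=> L0 rL; case: o => [z|n|n] /=.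
- by split=> [|_ [<-]]; lia.
- by have := rL n; split=> [|_ [<-]]; lia.
have h1 := rL n; have h2 := rL `|r n|%N; split; first by lia.
by rewrite /reg_at; case: ifP => //= _ _ [<-]; lia.
Qed.

Lemma address_bound L r o :
  (forall k, bitlen (r k) <= L)%N -> (address_cost r o <= operand_size o + L)%N.
Proof. by move=> rL; case: o => //= n; have := rL n; lia. Qed.

Lemma upd_bound B r n z : (forall k, bitlen (r k) <= B)%N -> (bitlen z <= B)%N ->
  forall k, (bitlen (upd r n z k) <= B)%N.
Proof. by move=> rB zB k; rewrite /upd; case: ifP. Qed.

(** The result of an arithmetic operation has at most as many digits as both
  operands together, and an operand is a register or a literal of the program. *)
Lemma step_wide P : exists C, forall L s s', (0 < L)%N -> wide L s ->
  step P s = Some s' -> (step_cost P s <= C * L)%N /\ wide (C * L) s'.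
Proof.
pose c := (\sum_(ins <- P) instr_size ins)%N.
(* The constants of [P] contribute at most [c] <= c * L digits. *)
exists (c + 4)%N => L [pc r i o] s' L0 [/= rL iL].
rewrite /step /step_cost; case E : (onth P pc) => [ins|//].
have sz : (instr_size ins <= c)%N.
  have insP : List.In ins P.
    elim: (P) pc E => [|x P' IH] [|pc] //= => [[->]|/IH]; by [left|right].
  rewrite /c; elim: (P) insP => //= x P' IH [->|/IH h]; rewrite big_cons; lia.
have mon B : (L <= B)%N -> (forall k, bitlen (r k) <= B)%N /\ all (fun z => bitlen z <= B)%N i.
  move=> LB; split=> [k|]; first exact: leq_trans (rL k) LB.
  by apply: sub_all iL => z zL; apply: leq_trans zL LB.
have big : (c + 3 * L <= (c + 4) * L)%N by nia.
have [mr mi] := mon ((c + 4) * L)%N ltac:(nia).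
have acc f a : (instr_size (LOAD a) <= c)%N ->
  (forall z, bitlen (f z) <= L + bitlen z)%N ->
  omap (fun z => State pc.+1 (upd r 0 (f z)) i o) (value r a) = Some s' ->
  (value_cost r a <= c + 2 * L)%N /\ wide ((c + 4) * L) s'.
  move=> sa hf; have [vc vb] := value_bounds a L0 rL.
  case V : (value r a) => [z|//] [<-]; rewrite /= in sa; split; first by lia.
  split=> //=; apply: upd_bound => //; have := hf z; have := vb _ V; lia.
have h0 := rL 0%N.
case: ins sz {E} => [a|a|a|a|a|a|a|l|l|l|] sz.
- move=> /(acc _ _ sz) [] => [z|hc w]; first by rewrite leq_addl.
  by split=> //; lia.
- have ha := address_bound a rL; case: (address r a) => [n|//] [<-].
  by rewrite /= in sz; split; [lia|split=> //=; apply: upd_bound].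
- move=> /(acc _ _ sz) [] => [z|hc w]; first by have := bitlenD (r 0%N) z; lia.
  by split=> //; lia.
- move=> /(acc _ _ sz) [] => [z|hc w].
    by have := bitlenD (r 0%N) (- z); rewrite bitlenN; lia.
  by split=> //; lia.
- move=> /(acc _ _ sz) [] => [z|hc w]; first by have := bitlenM (r 0%N) z; lia.
  by split=> //; lia.
- have ha := address_bound a rL; case: i iL mi mon acc => //= z i /andP[zL _] /andP[zB iB] _ _.
  case: (address r a) => [n|//] [<-].
  by rewrite /= in sz; split; [lia|split=> //=; apply: upd_bound].
- have [vc _] := value_bounds a L0 rL; case: (value r a) => [z|//] [<-].
  by rewrite /= in sz; split; [lia|].
- by case=> <-; split; [lia|].
- by case=> <-; split; [lia|].
- by case=> <-; split; [lia|].
- by [].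
Qed.

(** Iterating [step_wide], the numbers stay proportional to [L] during a bounded
  number of instructions. *)
Lemma steps_reach P N : exists C, forall n L s s', (n <= N)%N -> (0 < L)%N ->
  wide L s -> steps P n s = Some s' -> exists2 t, (t <= C * L)%N & reach P s s' t.
Proof.
have [C stepC] := step_wide P.
elim: N => [|N [C' IH]]; first by exists 0%N => -[|//] L s s' _ _ _ [<-]; exists 0%N.
exists (C + C' * C)%N => -[|n] L s s' nN L0 ws /=; first by case=> <-; exists 0%N.
case E : (step P s) => [s1|//] /= run.
have [cost w1] := stepC _ _ _ L0 ws E.
have CL : (0 < C * L)%N by have [+ _] := w1; move=> /(_ 0%N); apply: leq_trans.
have [t tC rt] := IH _ _ _ _ nN CL w1 run.
exists (step_cost P s + t)%N; first by rewrite mulnDl -mulnA leq_add.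
by move=> out T h; rewrite -addnA; apply: halts_step E _; apply: rt.
Qed.

Lemma stepsD P m n s : steps P (m + n) s = obind (steps P n) (steps P m s).
Proof. by elim: m s => [|m IH] s //=; case: (step P s). Qed.

(** The memory whose first registers hold [l] and whose other registers, numbered
  from 0, hold [b].  The recursion is on the address so that an address such as
  k.+4 reduces past the first four registers for a variable k. *)
Fixpoint regs (l : seq int) (b : nat -> int) (k : nat) {struct k} : int :=
  match l, k with
  | [::], _ => b k
  | x :: _, 0%N => x
  | _ :: l', k'.+1 => regs l' b k'
  end.

Lemma regs_nil b k : regs [::] b k = b k.
Proof. by case: k. Qed.

(** Updates in this representation; keeping memories in the form [regs l b] makes
  symbolic execution possible by mere reduction. *)
Fixpoint set_reg (l : seq int) (b : nat -> int) (n : nat) (z : int) : seq int * (nat -> int) :=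
  match l, n with
  | [::], _ => ([::], upd b n z)
  | _ :: l', 0%N => (z :: l', b)
  | x :: l', n'.+1 => let: (l2, b2) := set_reg l' b n' z in (x :: l2, b2)
  end.

Lemma upd_regs l b n z : upd (regs l b) n z = regs (set_reg l b n z).1 (set_reg l b n z).2.
Proof.
apply/funext => k; elim: l n k => [|x l IH] [|n] [|k] //=; rewrite ?regs_nil //.
  by rewrite /upd /=; case: (set_reg l b n z).
by have := IH n k; rewrite /upd eqSS; case: (set_reg l b n z).
Qed.

(** * The program and its symbolic execution *)

(** Register 0 is the accumulator.  While the cell (i, j) is processed, [rI] holds i,
  [rU] holds i - (d+1) and [rV] holds i + j - (d+1).  The latter two count up to
  0, so that a test for zero detects the end of a row and the last row; [rV] is moreover
  the factor in the right-hand side of the equation.  The previous row is stored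
  from address 20 on, the current one overwriting it; [rP] and [rQ] hold the
  addresses of its entries j and j + 1.  The equation is formed in [rA], [rB] and
  [rE], the six inner products in [rAA] to [rEE]. *)
Local Notation rU := 1%N.
Local Notation rI := 2%N.
Local Notation rV := 3%N.
Local Notation rP := 4%N.
Local Notation rQ := 5%N.
Local Notation rC := 6%N.
Local Notation rA := 7%N.
Local Notation rB := 8%N.
Local Notation rE := 9%N.
Local Notation rAA := 10%N.
Local Notation rAB := 11%N.
Local Notation rBB := 12%N.
Local Notation rAE := 13%N.
Local Notation rBE := 14%N.
Local Notation rEE := 15%N.
Local Notation rDen := 16%N.
Local Notation rN1 := 17%N.
Local Notation rN2 := 18%N.
Local Notation rT := 19%N.

(** Positions in [prog] of the jump targets. *)
Local Notation lHead := 9%N.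
Local Notation lRow := 56%N.
Local Notation lFinal := 69%N.
Local Notation lSing := 92%N.
Local Notation lTest := 99%N.
Local Notation lYes := 112%N.

Definition add_product (s x y : nat) : program :=
  [:: LOAD (Reg x); MULT (Reg y); ADD (Reg s); STORE (Reg s)].

Definition store_minor (s x y z w : nat) : program :=
  [:: LOAD (Reg z); MULT (Reg w); STORE (Reg rT);
      LOAD (Reg x); MULT (Reg y); SUB (Reg rT); STORE (Reg s)].

(** The blocks: initialisation; one cell (head of the loop, equation, six
  accumulations, next cell); next row; least squares solution, its generic
  case first; exactness test and output. *)
Definition prog : program :=
  [:: READ (Reg rU); LOAD (Lit (-1)); SUB (Reg rU); STORE (Reg rU); STORE (Reg rV);
      LOAD (Lit 20); STORE (Reg rP); ADD (Lit 1); STORE (Reg rQ)]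
  ++ [:: LOAD (Reg rV); JZERO lRow;
      READ (Reg rC); LOAD (Reg rI); MULT (Reg rC); STORE (Reg rA);
      LOAD (Reg rQ); SUB (Lit 20); MULT (Ind rQ); STORE (Reg rB);
      LOAD (Reg rV); MULT (Ind rP); STORE (Reg rE);
      LOAD (Reg rC); STORE (Ind rP)]
  ++ add_product rAA rA rA ++ add_product rAB rA rB ++ add_product rBB rB rB
  ++ add_product rAE rA rE ++ add_product rBE rB rE ++ add_product rEE rE rE
  ++ [:: LOAD (Reg rQ); STORE (Reg rP); ADD (Lit 1); STORE (Reg rQ);
      LOAD (Reg rV); ADD (Lit 1); STORE (Reg rV); JUMP lHead]
  ++ [:: LOAD (Reg rI); ADD (Lit 1); STORE (Reg rI);
      LOAD (Lit 20); STORE (Reg rP); ADD (Lit 1); STORE (Reg rQ);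
      LOAD (Reg rU); ADD (Lit 1); STORE (Reg rU); STORE (Reg rV);
      JZERO lFinal; JUMP lHead]
  ++ store_minor rDen rAA rBB rAB rAB ++ [:: JZERO lSing]
  ++ store_minor rN1 rAE rBB rAB rBE ++ store_minor rN2 rAA rBE rAB rAE ++ [:: JUMP lTest]
  ++ [:: LOAD (Reg rAA); ADD (Reg rBB); STORE (Reg rDen);
      LOAD (Reg rAE); STORE (Reg rN1); LOAD (Reg rBE); STORE (Reg rN2)]
  ++ [:: LOAD (Reg rDen); MULT (Reg rEE); STORE (Reg rT);
      LOAD (Reg rN1); MULT (Reg rAE); SUB (Reg rT); STORE (Reg rT);
      LOAD (Reg rN2); MULT (Reg rBE); ADD (Reg rT); JZERO lYes;
      WRITE (Lit 0); HALT]
  ++ [:: WRITE (Lit 1); WRITE (Reg rN1); WRITE (Reg rDen); WRITE (Reg rN2);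
      WRITE (Reg rDen); HALT].

Lemma run_step P n s s' r :
  step P s = Some s' -> steps P n s' = r -> steps P n.+1 s = r.
Proof. by move=> /= ->. Qed.

Lemma reg_atE r n : reg_at r (Posz n) = Some n.
Proof. by []. Qed.

Arguments steps : simpl never.
Arguments upd : simpl never.
Arguments reg_at : simpl never.

(** Executes one instruction symbolically and returns to the form [regs l b]. *)
Ltac run1 := eapply run_step;
  [rewrite /= ?reg_atE /= ?regs_nil ?upd_regs /=; reflexivity|].

Lemma ptr_succ (n : nat) : n%:Z + 1 = n.+1%:Z. Proof. by rewrite intS addrC. Qed.

Lemma ptr_base (n : nat) : n.+4.+4.+4.+4.+4%:Z - 20 = n%:Z. Proof. lia. Qed.

(** The addresses in [rP] and [rQ] are written with 20 successors so that indirect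
  accesses reduce. *)
Definition head_state (acc u i v : int) (p q : nat) (c a b e s1 s2 s3 s4 s5 s6 : int)
    (buf : nat -> int) (inp : seq int) : state :=
  State lHead (regs [:: acc; u; i; v; p.+4.+4.+4.+4.+4%:Z; q.+4.+4.+4.+4.+4%:Z; c; a; b; e;
    s1; s2; s3; s4; s5; s6; 0; 0; 0; 0] buf) inp [::].

Lemma run_init (d : int) inp :
  steps prog 9 (init (d :: inp)) =
  Some (head_state (20 + 1) (- 1 - d) 0 (- 1 - d) 0 1 0 0 0 0 0 0 0 0 0 0 (fun=> 0) inp).
Proof.
have -> : init (d :: inp) = State 0 (regs (nseq 20 0) (fun=> 0)) (d :: inp) [::].
  by rewrite /init; congr State; apply/funext; do 20?[case=> //]; case.
by do 9 run1.
Qed.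

(** The effect of one turn of the loop, in which the input [z] is the new
  coefficient: it replaces the entry j of the stored row after that entry has
  been used. *)
Lemma run_cell (acc u i v : int) j (c a b e s1 s2 s3 s4 s5 s6 : int) buf z inp :
  v != 0 ->
  let a' := i * z in let b' := j.+1%:Z * buf j.+1 in let e' := v * buf j in
  steps prog 47 (head_state acc u i v j j.+1 c a b e s1 s2 s3 s4 s5 s6 buf (z :: inp)) =
  Some (head_state (v + 1) u i (v + 1) j.+1 j.+2 z a' b' e' (a' * a' + s1) (a' * b' + s2)
    (b' * b' + s3) (a' * e' + s4) (b' * e' + s5) (e' * e' + s6) (upd buf j z) inp).
Proof.
move=> v0 a' b' e'; rewrite /head_state.
do 2 run1; rewrite (negPf v0).
do 6 run1; rewrite ptr_base.
do 39 run1; by rewrite ptr_succ.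
Qed.

Lemma run_row (acc u i : int) j (c a b e s1 s2 s3 s4 s5 s6 : int) buf inp :
  u + 1 != 0 ->
  steps prog 15 (head_state acc u i 0 j j.+1 c a b e s1 s2 s3 s4 s5 s6 buf inp) =
  Some (head_state (u + 1) (u + 1) (i + 1) (u + 1) 0 1 c a b e s1 s2 s3 s4 s5 s6 buf inp).
Proof.
move=> u1; rewrite /head_state.
do 14 run1; rewrite (negPf u1).
by run1.
Qed.

Definition test_state (acc u i p q c a b e s1 s2 s3 s4 s5 s6 den n1 n2 t : int)
    (buf : nat -> int) (inp : seq int) : state :=
  State lTest (regs [:: acc; u; i; 0; p; q; c; a; b; e; s1; s2; s3; s4; s5; s6;
    den; n1; n2; t] buf) inp [::].

(** From the end of the last row to the exactness test.  The accumulator, the index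
  and the pointers are left unspecified. *)
Lemma run_solve (acc u i : int) j (c a b e s1 s2 s3 s4 s5 s6 : int) buf inp :
  u + 1 = 0 ->
  let det := s1 * s3 - s2 * s2 in
  let den := if det == 0 then s1 + s3 else det in
  let n1 := if det == 0 then s4 else s4 * s3 - s2 * s5 in
  let n2 := if det == 0 then s5 else s1 * s5 - s2 * s4 in
  exists n acc' i' p q t, (n <= 40)%N /\
    steps prog n (head_state acc u i 0 j j.+1 c a b e s1 s2 s3 s4 s5 s6 buf inp) =
    Some (test_state acc' 0 i' p q c a b e s1 s2 s3 s4 s5 s6 den n1 n2 t buf inp).
Proof.
move=> u0 det; rewrite /test_state.
have [D0|D0] /= := eqVneq det 0.
  (* The end of the row, the determinant, the solution. *)
  exists (14 + 8 + 7)%N; do 5!eexists; split=> //; rewrite /head_state.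
  do 14 run1; rewrite u0 eqxx.
  do 8 run1; rewrite -/det D0 eqxx.
  by do 7 run1.
exists (14 + 8 + 15)%N; do 5!eexists; split=> //; rewrite /head_state.
do 14 run1; rewrite u0 eqxx.
do 8 run1; rewrite -/det (negPf D0).
by do 15 run1.
Qed.

Lemma run_test (acc u i p q c a b e s1 s2 s3 s4 s5 s6 den n1 n2 t : int) buf inp :
  exists n s',
  [/\ (n <= 16)%N,
   steps prog n (test_state acc u i p q c a b e s1 s2 s3 s4 s5 s6 den n1 n2 t buf inp)
     = Some s',
   onth prog (spc s') = Some HALT &
   rev (sout s') = if n1 * s4 + n2 * s5 == den * s6 then [:: 1; n1; den; n2; den]
                   else [:: 0]].
Proof.
have testE : (n2 * s5 + (n1 * s4 - den * s6) == 0) = (n1 * s4 + n2 * s5 == den * s6).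
  by rewrite addrA subr_eq0 addrC.
rewrite /test_state; case: ifP => test.
  exists (11 + 5)%N; eexists; split=> //.
    do 11 run1; rewrite testE test.
    by do 5 run1.
  by [].
  by [].
exists (11 + 1)%N; eexists; split=> //.
  do 11 run1; rewrite testE test.
  by run1.
by [].
by [].
Qed.

Section Answer.
Variables (I : eqType) (ks : seq I) (a b e : I -> int).

Definition answer : seq int :=
  if lsq_exact ks a b e then
    [:: 1; lsq_num1 ks a b e; lsq_den ks a b; lsq_num2 ks a b e; lsq_den ks a b]
  else [:: 0].

Lemma run_final (acc u i : int) j (c0 a0 b0 e0 : int) buf inp : u + 1 = 0 ->
  exists n s',
  [/\ (n <= 56)%N,
   steps prog n (head_state acc u i 0 j j.+1 c0 a0 b0 e0 (dot ks a a) (dot ks a b)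
     (dot ks b b) (dot ks a e) (dot ks b e) (dot ks e e) buf inp) = Some s',
   onth prog (spc s') = Some HALT & rev (sout s') = answer].
Proof.
move=> u0.
have [n [acc' [i' [p [q [t [n_le run]]]]]]] := run_solve acc i j c0 a0 b0 e0
  (dot ks a a) (dot ks a b) (dot ks b b) (dot ks a e) (dot ks b e) (dot ks e e) buf inp u0.
have [n' [s' [n_le' run' halt' out']]] := run_test acc' 0 i' p q c0 a0 b0 e0
  (dot ks a a) (dot ks a b) (dot ks b b) (dot ks a e) (dot ks b e) (dot ks e e)
  (lsq_den ks a b) (lsq_num1 ks a b e) (lsq_num2 ks a b e) t buf inp.
exists (n + n')%N, s'; split=> //; first by lia.
by rewrite stepsD run.
Qed.

End Answer.

(** * Correctness and cost of the loop *)

Lemma size_cells d i j : size (cells d i j) = (size (cells d i 0) + j)%N.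
Proof. by rewrite /cells !size_cat size_map size_iota addn0. Qed.

Lemma size_cells_row d i : size (cells d i.+1 0) = (size (cells d i 0) + (d.+1 - i))%N.
Proof. by rewrite -cells_row size_cells. Qed.

Lemma size_cells_le d i j : (size (cells d i j) <= i * d.+1 + j)%N.
Proof.
rewrite size_cells leq_add2r; elim: i => [|i IH] //.
by rewrite size_cells_row mulSn addnC leq_add // leq_subr.
Qed.

Lemma size_cells_ge d i : (i <= d.+1)%N -> (i <= size (cells d i 0))%N.
Proof.
elim: i => // i IH id; rewrite size_cells_row; have := IH (ltnW id); lia.
Qed.

Lemma dot_rcons (F : realDomainType) (I : eqType) (ks : seq I) k (u v : I -> F) :
  dot (rcons ks k) u v = u k * v k + dot ks u v.
Proof. by rewrite /dot -cats1 big_cat big_seq1 addrC. Qed.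

Lemma bitlen_small n L : (0 < L)%N -> (n < 2 ^ L)%N -> (bitlen n%:Z <= L)%N.
Proof. by move=> L0 nL; rewrite bitlen_leq. Qed.

Lemma bitlen_sum (I : eqType) (ks : seq I) (g : I -> int) B K :
  (0 < B)%N -> {in ks, forall k, bitlen (g k) <= B}%N -> (size ks <= 2 ^ K)%N ->
  (bitlen (\sum_(k <- ks) g k)%R <= B + K)%N.
Proof.
move=> B0 gB ksK; rewrite bitlen_leq ?addn_gt0 ?B0 // expnD.
suff : (absz (\sum_(k <- ks) g k)%R <= size ks * (2 ^ B).-1)%N.
  have : (0 < 2 ^ B)%N by rewrite expn_gt0.
  have : (0 < 2 ^ K)%N by rewrite expn_gt0.
  by nia.
elim: ks gB {ksK} => [|k ks IH] gB; first by rewrite big_nil.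
rewrite big_cons /=.
have := IH (fun x xin => gB x (mem_behead (s := k :: ks) xin)).
have := gB k (mem_head _ _); rewrite bitlen_leq // mulSn.
set y := \sum_(x <- ks) g x; set X := (size ks * _)%N; set Y := (2 ^ B)%N.
lia.
Qed.

Section Loop.
Variables (d S : nat) (c : nat -> nat -> int).
Hypotheses (S_gt0 : (0 < S)%N) (dS : (d.+1 <= S)%N).
Hypothesis (cS : forall x y, (x + y <= d)%N -> (bitlen (c x y) <= S)%N).

(** The part of the input that remains to be read at cell (i, j). *)
Definition rest (i j : nat) : seq int :=
  [seq c i y | y <- iota j (d.+1 - i - j)] ++
  [seq c x y | x <- iota i.+1 (d - i), y <- iota 0 (d.+1 - x)].

Lemma rest_cell i j : (j < d.+1 - i)%N -> rest i j = c i j :: rest i j.+1.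
Proof.
move=> ji; rewrite /rest subnS.
by case: (d.+1 - i - j)%N (subn_gt0 j (d.+1 - i)); rewrite ji.
Qed.

Lemma rest_row i : (i < d)%N -> rest i (d.+1 - i) = rest i.+1 0.
Proof.
move=> id; rewrite /rest subnn /= subn0 -[(d - i)%N]prednK ?subn_gt0 //=.
by rewrite -subnS.
Qed.

Lemma rest_le i j x : (i <= d)%N -> x \in rest i j -> (bitlen x <= S)%N.
Proof.
move=> id; rewrite mem_cat => /orP[/mapP[y]|/allpairsPdep[u [v []]]].
  by rewrite mem_iota => yj ->; apply: cS; lia.
by rewrite !mem_iota => uj vj ->; apply: cS; lia.
Qed.

Local Notation A := (eq_a c).
Local Notation B := (eq_b c).
Local Notation E := (eq_e d c).

(** The head of the loop at cell (i, j).  The stored row consists of the entries of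
  row i already read followed by those of row i - 1; nothing is known beyond
  column d + 1 - i, where older rows subsist and which is not accessed any more.
  The temporaries [acc], [c0], [a0], [b0] and [e0] matter only through their
  size. *)
Definition loop_inv (i j : nat) (s : state) : Prop :=
  exists acc c0 a0 b0 e0 buf,
  [/\ s = head_state acc (i%:Z - d.+1%:Z) i%:Z ((i + j)%:Z - d.+1%:Z) j j.+1 c0 a0 b0 e0
        (dot (cells d i j) A A) (dot (cells d i j) A B) (dot (cells d i j) B B)
        (dot (cells d i j) A E) (dot (cells d i j) B E) (dot (cells d i j) E E)
        buf (rest i j),
     all (fun z => bitlen z <= 6 * S)%N [:: acc; c0; a0; b0; e0],
     forall k, (bitlen (buf k) <= S)%N,
     forall k, (k < j)%N -> buf k = c i k &
     forall k, (j <= k)%N -> (i + k <= d.+1)%N -> buf k = above c i k].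

Lemma pow_gt : (S < 2 ^ S)%N. Proof. exact: ltn_expl. Qed.

Lemma bitlen_index (z : int) : (`|z| <= d.+1)%N -> (bitlen z <= S)%N.
Proof. by move=> zd; rewrite bitlen_leq //; have := pow_gt; lia. Qed.

Lemma above_le i j : (i + j <= d.+1)%N -> (bitlen (above c i j) <= S)%N.
Proof. by case: i => [|i] ij //=; apply: cS. Qed.

Lemma system_le k : (k.1 + k.2 <= d)%N ->
  [/\ bitlen (A k) <= 2 * S, bitlen (B k) <= 2 * S & bitlen (E k) <= 2 * S]%N.
Proof.
case: k => x y /= xy; rewrite mul2n -addnn.
split; apply: leq_trans (bitlenM _ _) _; apply: leq_add.
- by apply: bitlen_index; rewrite /=; lia.
- exact: cS.
- by apply: bitlen_index; rewrite /=; lia.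
- by apply: above_le => /=; lia.
- by apply: bitlen_index; rewrite /=; lia.
- by apply: above_le => /=; lia.
Qed.

Lemma mem_cells_le i j k : (i <= d)%N -> (j <= d.+1 - i)%N -> k \in cells d i j ->
  (k.1 + k.2 <= d)%N.
Proof.
move=> id ji; rewrite mem_cat => /orP[/allpairsPdep[u [v []]]|/mapP[y]].
  by rewrite !mem_iota => ? ? ->; rewrite /=; lia.
by rewrite mem_iota => ? ->; rewrite /=; lia.
Qed.

(** Entries of the columns have at most 2 S digits, and there are at most
  (d + 1)^2 <= 2^(2 S) cells. *)
Lemma dot_le i j (g h : nat * nat -> int) : (i <= d)%N -> (j <= d.+1 - i)%N ->
  (forall k, (k.1 + k.2 <= d)%N -> bitlen (g k) <= 2 * S)%N ->
  (forall k, (k.1 + k.2 <= d)%N -> bitlen (h k) <= 2 * S)%N ->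
  (bitlen (dot (cells d i j) g h) <= 6 * S)%N.
Proof.
move=> id ji gS hS.
have -> : (6 * S = (2 * S + 2 * S) + 2 * S)%N by lia.
apply: bitlen_sum => [|k /(mem_cells_le id ji) kd|]; first by lia.
  by apply: leq_trans (bitlenM _ _) _; rewrite leq_add ?gS ?hS.
apply: leq_trans (size_cells_le _ _ _) _.
rewrite mul2n -addnn expnD; have := pow_gt; nia.
Qed.

Lemma pointer_le n : (n <= d.+2)%N -> (bitlen n.+4.+4.+4.+4.+4%:Z <= 6 * S)%N.
Proof.
move=> nd; apply: bitlen_small; first by lia.
(* 2 ^ (5 S) leaves room for the offset 20, and 2 ^ S for the index. *)
have -> : (6 * S = 5 * S + S)%N by lia.
rewrite expnD expnM; have := pow_gt.
have : (2 ^ 5 <= (2 ^ 5) ^ S)%N by rewrite -{1}[(2 ^ 5)%N]expn1 leq_exp2l.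
by set X := ((2 ^ 5) ^ S)%N; set Y := (2 ^ S)%N; rewrite (_ : 2 ^ 5 = 32)%N //; nia.
Qed.

Lemma loop_inv_wide i j s : (i <= d)%N -> (j <= d.+1 - i)%N ->
  loop_inv i j s -> wide (6 * S) s.
Proof.
move=> id ji [acc [c0 [a0 [b0 [e0 [buf [-> junk bufS _ _]]]]]]].
have S1 : (1 <= 6 * S)%N by lia.
have wk1 z : (`|z| <= d.+1)%N -> (bitlen z <= 6 * S)%N by move=> /bitlen_index; lia.
have [hA hB hE] : [/\ (forall k, (k.1 + k.2 <= d)%N -> bitlen (A k) <= 2 * S)%N,
  (forall k, (k.1 + k.2 <= d)%N -> bitlen (B k) <= 2 * S)%N &
  (forall k, (k.1 + k.2 <= d)%N -> bitlen (E k) <= 2 * S)%N].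
  by split=> k /system_le[].
split; last first.
  by apply/allP => x /(rest_le id) xS; rewrite /=; lia.
move=> k; rewrite /head_state /sreg.
have regsP l : all (fun z => bitlen z <= 6 * S)%N l -> (bitlen (regs l buf k) <= 6 * S)%N.
  elim: l k => [|x l IH] k; first by rewrite regs_nil; have := bufS k; lia.
  by case: k => [|k] /= /andP[xS lS] //; apply: IH.
apply: regsP; move: junk => /= /and5P[-> -> -> -> /andP[-> _]].
rewrite !dot_le // !pointer_le ?wk1 //; lia.
Qed.

Lemma loop_cell i j s : (i <= d)%N -> (j < d.+1 - i)%N -> loop_inv i j s ->
  exists2 s', steps prog 47 s = Some s' & loop_inv i j.+1 s'.
Proof.
move=> id ji [acc [c0 [a0 [b0 [e0 [buf [-> junk bufS buf_lt buf_ge]]]]]]].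
have v0 : (i + j)%:Z - d.+1%:Z != 0 by lia.
rewrite rest_cell //; eexists; first exact: run_cell.
have bufj : buf j = above c i j by apply: buf_ge; lia.
have bufj1 : buf j.+1 = above c i j.+1 by apply: buf_ge; lia.
have [hA hB hE] := @system_le (i, j) ltac:(rewrite /=; lia).
have cij : (bitlen (c i j) <= S)%N by apply: cS; lia.
rewrite /loop_inv cells_next !dot_rcons bufj bufj1.
exists ((i + j)%:Z - d.+1%:Z + 1), (c i j), (A (i, j)), (B (i, j)), (E (i, j)).
exists (upd buf j (c i j)); split.
- by congr head_state; lia.
- have vS : (bitlen ((i + j)%:Z - d.+1%:Z + 1)%R <= S)%N by apply: bitlen_index; lia.
  by apply/and5P; split; rewrite ?andbT; lia.
- by apply: upd_bound.
- by move=> k; rewrite /upd ltnS leq_eqVlt; case: eqP => [->|_ /buf_lt].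
- by move=> k jk ik; rewrite /upd gtn_eqF // buf_ge // ltnW.
Qed.

Lemma loop_row i s : (i < d)%N -> loop_inv i (d.+1 - i) s ->
  exists2 s', steps prog 15 s = Some s' & loop_inv i.+1 0 s'.
Proof.
move=> id [acc [c0 [a0 [b0 [e0 [buf [-> junk bufS buf_lt buf_ge]]]]]]].
have -> : (i + (d.+1 - i))%:Z - d.+1%:Z = 0 by lia.
rewrite rest_row //; eexists; first by apply: run_row; lia.
rewrite /loop_inv cells_row.
exists (i%:Z - d.+1%:Z + 1), c0, a0, b0, e0, buf; split=> //.
- by congr head_state; lia.
- move: junk => /= /andP[_ ->]; rewrite andbT.
  by apply: leq_trans (bitlen_index _) _; lia.
- by move=> k _ ik; apply: buf_lt; lia.
Qed.

Lemma loop_start (inp := d%:Z :: rest 0 0) :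
  exists2 s, steps prog 9 (init inp) = Some s & loop_inv 0 0 s.
Proof.
eexists; first exact: run_init.
exists (20 + 1), 0, 0, 0, 0, (fun=> 0).
have dot0 (g h : nat * nat -> int) : dot (cells d 0 0) g h = 0 by rewrite /dot big_nil.
rewrite !dot0; split=> //.
- by congr head_state; lia.
(* The accumulator still holds the address 21. *)
- have S6 : (5 <= 6 * S)%N by lia.
  have b0 : (bitlen 0 <= 6 * S)%N by apply: leq_trans S6.
  by rewrite /= b0 !andbT; apply: leq_trans S6; apply: (@bitlen_small 21).
Qed.

Lemma loop_stop s : loop_inv d 1 s ->
  exists n s', [/\ (n <= 56)%N, steps prog n s = Some s',
    onth prog (spc s') = Some HALT & rev (sout s') = answer (cells d d.+1 0) A B E].
Proof.
move=> [acc [c0 [a0 [b0 [e0 [buf [-> _ _ _ _]]]]]]].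
have -> : (d + 1)%:Z - d.+1%:Z = 0 by lia.
rewrite -cells_row subSnn; apply: run_final; lia.
Qed.

Lemma init_wide : wide (6 * S) (init (d%:Z :: rest 0 0)).
Proof.
split=> [k|]; first by apply: leq_trans S_gt0 _; lia.
have dS' : (bitlen d%:Z <= S)%N by apply: bitlen_index; lia.
apply/allP => x; rewrite inE => /orP[/eqP->|/(rest_le (leq0n d)) xS]; rewrite /=; lia.
Qed.

(** [C] is a constant for at most 56 instructions of [prog], as given by
  [steps_reach]: no part of the program between two heads of the loop, and no run
  from the last row to the end, is longer. *)
Variable C : nat.
Hypothesis reachC : forall n L s s', (n <= 56)%N -> (0 < L)%N ->
  wide L s -> steps prog n s = Some s' -> exists2 t, (t <= C * L)%N & reach prog s s' t.
Let W := (C * (6 * S))%N.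

Lemma reach_block n s s' : (n <= 56)%N -> wide (6 * S) s -> steps prog n s = Some s' ->
  exists2 t, (t <= W)%N & reach prog s s' t.
Proof. by move=> n_le ws; apply: reachC => //; lia. Qed.

Lemma reach_row_end i n j s : (i <= d)%N -> (j + n = d.+1 - i)%N -> loop_inv i j s ->
  exists s' t, [/\ (t <= n * W)%N, reach prog s s' t & loop_inv i (d.+1 - i) s'].
Proof.
move=> id; elim: n j s => [|n IH] j s jn inv.
  by exists s, 0%N; split=> //; rewrite -jn addn0.
have ji : (j < d.+1 - i)%N by lia.
have [s1 run1 inv1] := loop_cell id ji inv.
have [t1 t1W r1] := @reach_block 47 _ _ isT (loop_inv_wide id (ltnW ji) inv) run1.
have [s2 [t2 [t2W r2 inv2]]] := IH j.+1 s1 (etrans (addSnnS j n) jn) inv1.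
exists s2, (t1 + t2)%N; split=> //; first by rewrite mulSn leq_add.
exact: reach_trans r1 r2.
Qed.

Lemma reach_end n i s : (i + n = d)%N -> loop_inv i 0 s ->
  exists s' t, [/\ (t <= n.+1 * (d.+2 * W))%N, reach prog s s' t & loop_inv d 1 s'].
Proof.
elim: n i s => [|n IH] i s iN inv; have i_le : (i <= d)%N by lia.
  have [s1 [t1 [t1W r1 inv1]]] := @reach_row_end i (d.+1 - i) 0 s i_le erefl inv.
  exists s1, t1; split=> //; last by move: inv1; rewrite (_ : i = d) ?subSnn //; lia.
  by apply: leq_trans t1W _; rewrite mul1n leq_mul2r; lia.
have [s1 [t1 [t1W r1 inv1]]] := @reach_row_end i (d.+1 - i) 0 s i_le erefl inv.
have id : (i < d)%N by lia.
have [s2 run2 inv2] := loop_row id inv1.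
have [t2 t2W r2] := @reach_block 15 _ _ isT (loop_inv_wide (ltnW id) (leqnn _) inv1) run2.
have [s3 [t3 [t3W r3 inv3]]] := IH i.+1 s2 (etrans (addSnnS i n) iN) inv2.
exists s3, (t1 + (t2 + t3))%N; split=> //; last first.
  exact: reach_trans r1 (reach_trans r2 r3).
rewrite mulSn addnA leq_add // -[d.+2]addn1 mulnDl mul1n leq_add //.
by apply: leq_trans t1W _; rewrite leq_mul2r; lia.
Qed.

Lemma prog_answers : exists2 T, (T <= (24 * C + 1) * S ^ 3)%N &
  computes prog (d%:Z :: rest 0 0) (answer (cells d d.+1 0) A B E) T.
Proof.
have [s1 run1 inv1] := loop_start.
have [t1 t1W r1] := @reach_block 9 _ _ isT init_wide run1.
have [s2 [t2 [t2W r2 inv2]]] := @reach_end d 0 s1 erefl inv1.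
have [n [s3 [n_le run3 halt3 out3]]] := loop_stop inv2.
have j1 : (1 <= d.+1 - d)%N by rewrite subSnn.
have w2 := loop_inv_wide (leqnn d) j1 inv2.
have [t3 t3W r3] := reach_block n_le w2 run3.
have h3 : halts prog s3 (answer (cells d d.+1 0) A B E) 1.
  have := halts_stop halt3; rewrite out3; congr halts.
  by case: (s3) halt3 => pc r i o /=; rewrite /step_cost => ->.
exists (t1 + (t2 + (t3 + 1)))%N; last by apply/r1/r2/r3.
(* The total is at most (2 + S (S + 1)) W + 1, where W = 6 C S. *)
have : (d.+1 * (d.+2 * W) <= S * (S.+1 * W))%N by rewrite !leq_mul.
have -> : (S ^ 3 = S * (S * S))%N by rewrite !expnS expn0 muln1.
rewrite /W in t1W t2W t3W *; nia.
Qed.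

End Loop.

(** * The algorithm *)

Section Encoding.
Variables (d : nat) (f : {mpoly int[2]}).
Let c i j := f@_(mon2 i j).

Lemma encode_inputE : encode_input d f = d%:Z :: rest d c 0 0.
Proof. by rewrite /encode_input /coeffs /rest !subn0. Qed.

Lemma coeffsE : coeffs d f = [seq c k.1 k.2 | k <- cells d d.+1 0].
Proof. by rewrite /coeffs /cells cats0 map_allpairs. Qed.

Lemma coeff_size_le x y : (x + y <= d)%N -> (bitlen (c x y) <= coeffs_size d f)%N.
Proof.
move=> xy; have cin : c x y \in coeffs d f.
  by rewrite coeffsE; apply/mapP; exists (x, y); rewrite ?mem_cells.
by rewrite /coeffs_size (big_rem _ cin) leq_addr.
Qed.

Lemma degree_lt_coeffs_size : (d.+1 <= coeffs_size d f)%N.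
Proof.
apply: leq_trans (size_cells_ge (leqnn d.+1)) _.
rewrite -(size_map (fun k => c k.1 k.2)) -coeffsE /coeffs_size -sum1_size.
by apply: leq_sum => x _; apply: bitlen_gt0.
Qed.

End Encoding.

Unset Implicit Arguments.
Theorem propositionA1 (R : realType) :
  exists (P : program) (p : {poly nat}),
    forall (d : nat) (f : {mpoly int[2]}),
      (1 <= d)%N -> msize f = d.+1 ->
      let fR : {mpoly R[2]} := map_mpoly intr f in
      exists (out : seq int) (T : nat),
        [/\ computes P (encode_input d f) out T,
            (T <= p.[coeffs_size d f])%N,
            homogeneous_translatable fR ->
              exists t : 'I_2 -> rat,
                encodes_yes out t /\
                homogeneous_after fR (fun i => ratr (t i))
          & ~ homogeneous_translatable fR -> encodes_no out].
Proof.
have [C reachC] := steps_reach prog 56.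
exists prog, ((24 * C + 1)%N *: 'X^3) => d f d_gt0 size_f fR.
pose c i j := f@_(mon2 i j).
have dS := degree_lt_coeffs_size d f.
have S_gt0 : (0 < coeffs_size d f)%N by apply: leq_trans dS.
have [T T_le run] := prog_answers S_gt0 dS (@coeff_size_le d f) reachC.
exists (answer (cells d d.+1 0) (eq_a c) (eq_b c) (eq_e d c)), T.
rewrite encode_inputE; split=> //.
- by rewrite hornerZ hornerXn.
- move=> /(solution_complete d_gt0 size_f) ex; exists (solution d f).
  split; last exact: solution_correct d_gt0 size_f ex.
  rewrite /answer ex.
  exists (fun i => if i == ord0 then lsq_num1 (cells d d.+1 0) (eq_a c) (eq_b c) (eq_e d c)
    else lsq_num2 (cells d d.+1 0) (eq_a c) (eq_b c) (eq_e d c)).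
  exists (fun=> lsq_den (cells d d.+1 0) (eq_a c) (eq_b c)).
  by split=> // _; apply: system_den_gt0.
- move=> nt; rewrite /encodes_no /answer; case: ifP => // ex; case: nt.
  by exists (fun i => ratr (solution d f i)); apply: solution_correct.
Qed.
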